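(* Let $X$ be the nilpotent $N\times N$ complex matrix in Jordan canonical form of Jordan type $(n,N-n)$, with Springer fiber $\mathcal{S}_X$. The Springer Schubert cells $\mathcal{C}^X_w=\mathcal{S}_X\cap\mathcal{C}_w$ that are nonempty are exactly those for the permutations $w=w_{\mathcal{M}}$ corresponding to standard noncrossing matchings $\mathcal{M}$ on $\{1,2,\ldots,N\}$ with at most $n$ arc starts and at most $N-n$ arc ends. Moreover, for each nonempty Springer Schubert cell, the map \[f_{\mathcal{M}}:\mathbb{C}^{|\mathcal{M}|}\to\mathcal{C}^X_{w_{\mathcal{M}}},\qquad \vec{v}\mapsto f_{\mathcal{M}}(\vec{v})B,\] is a bijection.
   Context: Flags. Let $1\le n\le N-1$. $B\subset GL_N(\mathbb{C})$ is the group of invertible upper-triangular matrices; $GL_N(\mathbb{C})/B$ is the flag variety, and $gB$ corresponds to the flag $V_\bullet=(V_1\subset\cdots\subset V_N=\mathbb{C}^N)$ with $V_i$ the span of the first $i$ columns of $g$. Each flag has a unique canonical representative $g$: each row and column has a pivot entry equal to $1$, and all entries below a pivot and to the right of a pivot are $0$; the pivots form a permutation matrix. For a permutation $w$ (with matrix $w\vec{e}_i=\vec{e}_{w(i)}$), the Schubert cell $\mathcal{C}_w$ is the set of flags whose canonical representative has pivots at $w$. $X$ is given by $X\vec{e}_1=X\vec{e}_{n+1}=\vec{0}$ and $X\vec{e}_j=\vec{e}_{j-1}$ otherwise. The Springer fiber is $\mathcal{S}_X=\{V_\bullet: XV_i\subseteq V_i\ \forall i\}$. Matchings. An arc $\alpha$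 is a pair of integers $init(\alpha)<term(\alpha)$. A matching on $\{1,\ldots,N\}$ is a set of arcs whose endpoints are pairwise distinct elements of $\{1,\ldots,N\}$; $|\mathcal{M}|$ is its number of arcs. It is noncrossing if no two arcs satisfy $init(\alpha')<init(\alpha)<term(\alpha')<term(\alpha)$, and standard if every integer $i$ with $init(\alpha)<i<term(\alpha)$ for some arc $\alpha$ is an endpoint of some arc. In a noncrossing matching, $\alpha'$ is nested above $\alpha$ if $init(\alpha')<init(\alpha)$ and $term(\alpha)<term(\alpha')$; the parent of $\alpha$ is the arc nested above $\alpha$ with the largest $init$. Write $anc(\alpha)$ for the parent of $\alpha$, or $0$ if there is none, $anc(0)=0$, $anc^j$ for the $j$-fold composition, $anc^0=\mathrm{id}$. Permutation. Let $k=|\mathcal{M}|$. For $1\le i\le N$ let $\mathcal{J}_{beg}(i),\mathcal{J}_{end}(i),\mathcal{J}_{not}(i)$ be the number of $j$ with $1\le j\le i-1$ that start an arc, end an arc, are on no arc, respectively. Define \[w_{\mathcal{M}}(i)=\begin{cases}\mathcal{J}_{end}(i)+\mathcal{J}_{not}(i)+1 & i\text{ on no arc},\ \mathcal{J}_{not}(i)<n-k,\\ n+\mathcal{J}_{beg}(i)+(\mathcal{J}_{not}(i)-(n-k))+1 & i\text{ on no arc},\ \mathcal{J}_{not}(i)\ge n-k,\\ n+\mathcal{J}_{beg}(i)+\max\{0,\mathcal{J}_{not}(i)-(n-k)\}+1 & i\text{ starts an arc},\\ \mathcal{J}_{end}(i)+\min\{\mathcal{J}_{not}(i),n-k\}+1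 & i\text{ ends an arc}.\end{cases}\] The map $f_{\mathcal{M}}$. For $\vec{v}\in\mathbb{C}^{|\mathcal{M}|}$, with coordinates $v_\alpha$ indexed by arcs and $v_0=0$, $f_{\mathcal{M}}(\vec{v})$ is the matrix obtained from the permutation matrix $w_{\mathcal{M}}$ by adding, for every arc $\alpha$, the vector $\sum_{j\ge1}v_{anc^{j-1}(\alpha)}\vec{e}_{r_0+j}$ to column $init(\alpha)$, where $r_0=\mathcal{J}_{end}(init(\alpha))+\min\{\mathcal{J}_{not}(init(\alpha)),n-k\}$. *)

(* Defs.v *)
(* All indices are 0-based: the integers 1..N, the rows and columns of an
   N x N matrix and the steps V_1, .., V_N of a flag are all indexed by 'I_N.
   Hence n + 1 becomes n, and the "+1" in the values of w_M disappears. *)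
From mathcomp Require Import all_boot all_order all_fingroup all_algebra.
From mathcomp Require Import boolp classical_sets functions reals.
From mathcomp.real_closed Require Export complex.

Set Implicit Arguments.
Unset Strict Implicit.
Unset Printing Implicit Defensive.

Import GRing.Theory.
Local Open Scope ring_scope.

Section Flags.
Variables (F : fieldType) (N : nat).

Definition subspaces := {ffun 'I_N -> {vspace 'cV[F]_N}}.
Implicit Types (V : subspaces) (g : 'M[F]_N) (w : 'S_N).

Definition is_flag V : Prop :=
  (forall i, \dim (V i) = i.+1) /\
  (forall i j : 'I_N, (i <= j)%N -> (V i <= V j)%VS).

(* For g in GL_N, the flag corresponding to the coset gB. *)
Definition flag_of g : subspaces :=
  [ffun i : 'I_N => <<[seq col j g | j : 'I_N <- enum 'I_N & (j <= i)%N]>>%VS].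

(* The pivots are the nonzero entries of the matrix of w, which sends e_j to
   e_(w j), that is, the entries (w j, j). *)
Definition canonical_rep w g : Prop :=
  forall j : 'I_N,
    [/\ g (w j) j = 1,
        forall i : 'I_N, (w j < i)%N -> g i j = 0
      & forall l : 'I_N, (j < l)%N -> g (w j) l = 0].

Definition schubert_cell w : set subspaces :=
  [set V | is_flag V /\
    exists g, [/\ g \in unitmx, canonical_rep w g & flag_of g = V]]%classic.

Definition jordan_mx (n : nat) : 'M[F]_N :=
  \matrix_(i, j) ((i.+1 == j :> nat) && (j != n :> nat))%:R.

Definition springer_fiber (n : nat) : set subspaces :=
  [set V | is_flag V /\
    forall i, (linfun (mulmx (jordan_mx n)) @: V i <= V i)%VS]%classic.

Definition springer_cell (n : nat) w : set subspaces :=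
  (springer_fiber n `&` schubert_cell w)%classic.

End Flags.

Arguments jordan_mx F N n : clear implicits.
Arguments springer_fiber F N n : clear implicits.
Arguments springer_cell F {N} n w.

Section Matchings.
Local Open Scope nat_scope.
Variables (N n : nat) (M : {set 'I_N * 'I_N}).

(* A pair (init, term) of M is an arc. *)
Definition is_matching : bool :=
  [forall a in M, a.1 < a.2] &&
  [forall a in M, forall b in M, (a != b) ==>
     [&& a.1 != b.1, a.1 != b.2, a.2 != b.1 & a.2 != b.2]].

Definition starts : {set 'I_N} := [set a.1 | a in M].
Definition ends : {set 'I_N} := [set a.2 | a in M].
Definition unmatched : {set 'I_N} := ~: (starts :|: ends).

Definition noncrossing : bool :=
  [forall a in M, forall b in M,
     ~~ [&& b.1 < a.1, a.1 < b.2 & b.2 < a.2]].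

Definition standard : bool :=
  [forall a in M, forall i : 'I_N,
     (a.1 < i < a.2) ==> (i \in starts :|: ends)].

Definition admissible : bool :=
  [&& is_matching, noncrossing, standard, #|starts| <= n & #|ends| <= N - n].

Definition Jbeg (i : 'I_N) : nat := #|[set j in starts | j < i]|.
Definition Jend (i : 'I_N) : nat := #|[set j in ends | j < i]|.
Definition Jnot (i : 'I_N) : nat := #|[set j in unmatched | j < i]|.

(* Truncated subtraction computes max {0, Jnot i - (n - k)}; n - k is itself
   not truncated when M is admissible. *)
Definition matching_perm (i : 'I_N) : nat :=
  let k := #|M| in
  if i \in starts then n + Jbeg i + (Jnot i - (n - k))
  else if i \in ends then Jend i + minn (Jnot i) (n - k)
  else if Jnot i < n - k then Jend i + Jnot i
  else n + Jbeg i + (Jnot i - (n - k)).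

Definition arc_of := {a : 'I_N * 'I_N | a \in M}.

Definition nested_above (b a : arc_of) : bool :=
  ((val b).1 < (val a).1) && ((val a).2 < (val b).2).

(* None plays the role of the arc 0; in a matching, the arc picked is unique. *)
Definition parent (a : arc_of) : option arc_of :=
  [pick b : arc_of | nested_above b a &&
     [forall c : arc_of, nested_above c a ==> ((val c).1 <= (val b).1)]].

Definition anc (j : nat) (a : arc_of) : option arc_of :=
  iter j (obind parent) (Some a).

Definition row0 (i : 'I_N) : nat := Jend i + minn (Jnot i) (n - #|M|).

End Matchings.

Section MatchingMap.
Variables (F : fieldType) (N n : nat) (M : {set 'I_N * 'I_N}).

(* The basis vector e_r, equal to 0 when r >= N. *)
Definition basis_vec (r : nat) : 'cV[F]_N := \col_i (i == r :> nat)%:R.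

Definition arc_coord (v : {ffun arc_of M -> F}) (o : option (arc_of M)) : F :=
  oapp v 0 o.

(* Bounding the sum over j by N loses nothing, as rows r0 + j with j >= N do
   not exist. *)
Definition arc_vec (v : {ffun arc_of M -> F}) (a : arc_of M) : 'cV[F]_N :=
  \sum_(j < N) arc_coord v (anc j a) *: basis_vec (row0 n M (val a).1 + j).

Definition matching_map (v : {ffun arc_of M -> F}) : 'M[F]_N :=
  \matrix_(i, c) (basis_vec (matching_perm n M c)
                  + \sum_(a : arc_of M | (val a).1 == c) arc_vec v a) i 0.

End MatchingMap.

(* Main.v *)
(* For a permutation w whose Springer Schubert cell is nonempty, X-stability
   forces w to be a shuffle: it is increasing on the columns with a pivot in the
   first Jordan block (the set U) and on the other ones. Reading the columns of
   U as closing parentheses and the others as opening ones, the matching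
   parentheses form the arcs of a standard noncrossing matching M, and w = w_M.

   In the canonical representative g of a flag of such a cell, the columns of U
   are basis vectors, and another column j is e_(w j) plus entries in the rows
   r with cnt U j <= r < n. Comparing X g_j with the previous column outside U,
   X-stability says that these entries are constant along diagonals running
   down and to the right (see [diag]), so that g is determined by its entries
   in the positions (cnt U j, j). The diagonal of a matched column ends with its
   arc, whereas that of an unmatched column reaches row n, which forces it to
   vanish. The diagonals crossing column init(alpha) are those of the ancestors
   of alpha, which gives f_M. *)
Require Import Defs.
From mathcomp Require Import all_boot all_order all_fingroup all_algebra.
From mathcomp Require Import boolp classical_sets functions reals.
From mathcomp Require Import fintype finset zify.
Set Implicit Arguments.
Unset Strict Implicit.
Unset Printing Implicit Defensive.
Import GRing.Theory.
Local Open Scope ring_scope.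

(** * Counting and shuffles *)

Section Counting.
Local Open Scope nat_scope.
Variable N : nat.
Implicit Types (A U : {set 'I_N}) (i j : 'I_N) (p q : nat).

(** The successor step hands over an ordinal, so that one can split on its membership in a set of
    columns. *)
Lemma leq_ord_ind (P : nat -> Prop) :
  P 0 -> (forall i, P i -> P i.+1) -> forall p, p <= N -> P p.
Proof.
move=> P0 PS; elim=> // p IHp ltpN.
exact: (PS (Ordinal ltpN) (IHp (ltnW ltpN))).
Qed.

Definition cnt A p : nat := #|[set j in A | j < p]|.

Lemma cnt0 A : cnt A 0 = 0.
Proof. by apply/eqP; rewrite cards_eq0; apply/eqP/setP=> i; rewrite !inE andbF. Qed.

Lemma cntS A i : cnt A i.+1 = (i \in A) + cnt A i.
Proof.
rewrite /cnt; case: (boolP (i \in A)) => iA.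
  rewrite [LHS](cardsD1 i) !inE iA leqnn; congr (_ + _).
  apply: eq_card => j; rewrite !inE ltnS leq_eqVlt.
  have -> : (j == i :> nat) = (j == i) by [].
  by case: (eqVneq j i) => [->|_]; rewrite ?ltnn ?andbF.
apply: eq_card => j; rewrite !inE ltnS leq_eqVlt.
have -> : (j == i :> nat) = (j == i) by [].
by case: (eqVneq j i) => [->|//]; rewrite (negbTE iA).
Qed.

Lemma cntN A : cnt A N = #|A|.
Proof. by apply: eq_card => j; rewrite !inE ltn_ord andbT. Qed.

Lemma leq_cnt A p q : p <= q -> cnt A p <= cnt A q.
Proof.
move=> lepq; apply/subset_leq_card/subsetP=> j; rewrite !inE.
by case/andP=> -> /= /leq_trans; apply.
Qed.

Lemma cnt_lt A i p : i \in A -> (cnt A i < cnt A p) = (i < p).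
Proof.
move=> iA; apply/idP/idP => [|ltip]; last first.
  by apply: leq_trans (leq_cnt A ltip); rewrite cntS iA.
by rewrite !ltnNge; apply: contra => /(leq_cnt A).
Qed.

Lemma cnt_setC A p : p <= N -> cnt A p + cnt (~: A) p = p.
Proof.
move: p; apply: leq_ord_ind => [|i IH]; first by rewrite !cnt0.
by rewrite !cntS in_setC; case: (i \in A) => /=; lia.
Qed.

Lemma cnt_max A p : cnt A p <= #|A|.
Proof. by apply/subset_leq_card/subsetP=> j; rewrite inE => /andP[]. Qed.

(* The permutation merging the increasing enumerations of U and of its
   complement. *)
Definition shuffle U i : nat :=
  if i \in U then cnt U i else #|U| + cnt (~: U) i.

Lemma shuffle_lt_card U i : (shuffle U i < #|U|) = (i \in U).
Proof.
rewrite /shuffle; case: (boolP (i \in U)) => iU; last by lia.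
by rewrite -(cntN U) cnt_lt ?ltn_ord.
Qed.

Lemma shuffle_ltN U i : shuffle U i < N.
Proof.
rewrite /shuffle; case: ifPn => iU.
  have := max_card (mem U); rewrite card_ord; apply: leq_trans.
  by rewrite -(cntN U) cnt_lt ?ltn_ord.
have: cnt (~: U) i < cnt (~: U) N by rewrite cnt_lt ?in_setC ?ltn_ord.
have := cnt_setC U (leqnn N); rewrite !cntN; lia.
Qed.

Lemma shuffle_mono U i j : (i \in U) = (j \in U) ->
  (shuffle U i < shuffle U j) = (i < j).
Proof.
rewrite /shuffle => <-; case: ifPn => iU; first exact: cnt_lt.
by rewrite ltn_add2l cnt_lt ?in_setC.
Qed.

Lemma shuffle_inj U : injective (fun i => Ordinal (shuffle_ltN U i)).
Proof.
move=> i j /(congr1 val) /= eqij.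
have eqU : (i \in U) = (j \in U) by rewrite -!shuffle_lt_card eqij.
case: (ltngtP i j) => [lt|lt|/val_inj //].
  by move: lt; rewrite -(shuffle_mono eqU) eqij ltnn.
by move: lt; rewrite -(shuffle_mono (esym eqU)) eqij ltnn.
Qed.

Definition shuffle_perm U : 'S_N := perm (@shuffle_inj U).

Lemma shuffle_permE U i : shuffle_perm U i = shuffle U i :> nat.
Proof. by rewrite permE. Qed.

(** Chaining the hypothesis over consecutive values makes [w] increasing on the positions with
    values below n and on the others. As each value is the number of positions with a smaller value,
    it can be found by counting inside [U] or its complement. *)
Lemma perm_shuffle n (w : 'S_N) : n <= N ->
  (forall i j, (w i).+1 = w j -> w j != n :> nat -> i < j) ->
  let U := [set i | w i < n] in #|U| = n /\ forall i, w i = shuffle U i :> nat.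
Proof.
move=> lenN incr U.
(* Induction on the gap between the two values, through the position [l] of the value just below
   [w j]. *)
have incr2 d : forall i j, (w i + d).+1 = w j -> (w i < n) = (w j < n) -> i < j.
  elim: d => [|d IHd] i j eqw eqU.
    by apply: incr; [lia | apply/eqP; lia].
  have ltN : w i + d.+1 < N by have := ltn_ord (w j); lia.
  pose l := (w^-1)%g (Ordinal ltN).
  have wl : w l = w i + d.+1 :> nat by rewrite permKV.
  apply: (@ltn_trans l); first by apply: IHd; [lia | lia].
  by apply: incr; [lia | apply/eqP; lia].
have mono i j : (w i < n) = (w j < n) -> (w i < w j) = (i < j).
  have half x y : (w x < n) = (w y < n) -> w x < w y -> x < y.
    by move=> e lt; apply: (incr2 (w y - (w x).+1)) => //; lia.
  move=> e; apply/idP/idP; first exact: half.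
  move=> ltij; rewrite ltnNge leq_eqVlt; apply/negP => /orP[/eqP/val_inj/perm_inj|].
    by move=> eji; rewrite eji ltnn in ltij.
  by move/half => /(_ (esym e)); lia.
have wcard (P : pred nat) : #|[set i | P (w i)]| = #|[set r : 'I_N | P r]|.
  rewrite -(card_preimset [set r : 'I_N | P r] (@perm_inj _ w)).
  by apply: eq_card => i; rewrite !inE.
have count p : p <= N -> #|[set r : 'I_N | r < p]| = p.
  move=> lep; have := cnt_setC [set: 'I_N] lep; rewrite setCT.
  rewrite /cnt [X in _ + X]eq_card0 ?addn0; last by move=> j; rewrite !inE.
  by move=> {2}<-; apply: eq_card => j; rewrite !inE.
have cardU : #|U| = n by rewrite /U (wcard (fun r => r < n)) count.
split=> // i; rewrite /shuffle cardU inE.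
have := ltn_ord (w i) => ltwN.
case: ifPn => [lt|]; [|rewrite -leqNgt => le].
  rewrite -[LHS]count ?(ltnW ltwN) // -(wcard (fun r => r < w i)).
  apply: eq_card => j; rewrite !inE.
  by case: (ltnP (w j) n) => ltj; [rewrite mono ?lt ?ltj // | lia].
have -> : cnt (~: U) i = #|[set r : 'I_N | n <= r < w i]|.
  rewrite -(wcard (fun r => n <= r < w i)); apply: eq_card => j; rewrite !inE -leqNgt.
  by case: (leqP n (w j)) => //= ltj; rewrite mono // !ltnNge le ltj.
have -> : [set r : 'I_N | n <= r < w i]
    = [set r : 'I_N | r < w i] :\: [set r : 'I_N | r < n].
  by apply/setP=> r; rewrite !inE -leqNgt.
rewrite cardsDS; last by apply/subsetP=> r; rewrite !inE => /leq_trans; apply.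
by rewrite !count ?(ltnW ltwN) //; lia.
Qed.

End Counting.

(** * Flags and canonical representatives *)

Section Flags.
Variables (F : fieldType) (N : nat).
Implicit Types (g : 'M[F]_N) (w : 'S_N) (i j l : 'I_N) (x y c : 'cV[F]_N).

Lemma mulmx_col_sum g c : g *m c = \sum_l c l 0 *: col l g.
Proof.
by apply/colP=> k; rewrite !mxE summxE; apply: eq_bigr => l _; rewrite !mxE mulrC.
Qed.

Lemma flag_ofP g j x :
  reflect (exists2 c : 'cV[F]_N, (forall l, (j < l)%N -> c l 0 = 0) & x = g *m c)
          (x \in flag_of g j).
Proof.
have -> : flag_of g j = (\sum_(l : 'I_N | (l <= j)%N) <[col l g]>)%VS.
  by rewrite ffunE span_def big_map big_filter big_enum_cond; apply: eq_bigl.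
apply: (iffP memv_sumP) => [[vs vsP ->]|[c c0 ->]].
  have /fin_all_exists [k kP] l : exists a, (l <= j)%N -> vs l = a *: col l g.
    case: (leqP l j) => [lelj|_]; last by exists 0.
    by have /vlineP[a ->] := vsP l lelj; exists a.
  exists (\col_l if (l <= j)%N then k l else 0) => [l ltjl|].
    by rewrite mxE leqNgt ltjl.
  rewrite mulmx_col_sum [RHS](bigID (fun l : 'I_N => (l <= j)%N)) /=.
  rewrite [X in _ = _ + X]big1 ?addr0.
    by apply: eq_bigr => l lelj; rewrite mxE lelj kP.
  by move=> l /negbTE nle; rewrite mxE nle scale0r.
exists (fun l => c l 0 *: col l g) => [l _|]; first by rewrite memvZ ?memv_line.
rewrite mulmx_col_sum (bigID (fun l : 'I_N => (l <= j)%N)) /= addrC big1 ?add0r //.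
by move=> l; rewrite -ltnNge => /c0->; rewrite scale0r.
Qed.

Lemma flag_of_col g i j : (i <= j)%N -> col i g \in flag_of g j.
Proof.
move=> leij; apply/flag_ofP; exists (delta_mx i 0); last exact: colE.
move=> l ltjl; rewrite mxE andbT; case: eqP => // eli; move: ltjl.
by rewrite eli ltnNge leij.
Qed.

Lemma flag_of_is_flag g : g \in unitmx -> is_flag (flag_of g).
Proof.
move=> gU; split=> [i|i j leij]; last first.
  apply/subvP=> x /flag_ofP[c c0 ->]; apply/flag_ofP; exists c => // l ltjl.
  exact/c0/(leq_ltn_trans leij).
pose X := [seq col j g | j <- enum 'I_N].
have freeX : free X.
  suff /basis_free : basis_of fullv X by [].
  rewrite basisEdim size_map size_enum_ord dimvf /dim /= muln1 leqnn andbT.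
  apply/subvP=> x _; rewrite -(mulKVmx gU x); set c := invmx g *m x.
  rewrite mulmx_col_sum; apply: memv_suml => l _.
  by apply: rpredZ; apply: memv_span; apply: (map_f (fun j => col j g)); rewrite mem_enum.
(* The columns up to [i] are a segment of a permutation of all columns, hence free. *)
have freeV : free [seq col j g | j : 'I_N <- enum 'I_N & (j <= i)%N].
  have := perm_filterC (fun j : 'I_N => (j <= i)%N) (enum 'I_N).
  move/(_ (enum 'I_N)); rewrite perm_refl => /(perm_map (fun j => col j g)) /perm_free.
  by rewrite freeX map_cat => /catl_free.
rewrite ffunE; move: freeV; rewrite /free => /eqP->.
rewrite size_map size_filter.
have := cnt_setC [set: 'I_N] (ltn_ord i : i.+1 <= N)%N; rewrite setCT.
rewrite /cnt [X in (_ + X)%N]eq_card0 ?addn0; last by move=> j; rewrite !inE.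
move=> <-; rewrite -sum1_count big_enum_cond sum1_card.
by apply: eq_card => j; rewrite !inE ltnS.
Qed.

(** Among the columns with nonzero coefficient, take the one with the lowest pivot: the others
    vanish in its pivot row and all vanish below it, so nothing cancels. *)
Lemma canonical_rep_leading w g c : canonical_rep w g -> c != 0 ->
  exists l, [/\ c l 0 != 0, (g *m c) (w l) 0 = c l 0
              & forall i, (w l < i)%N -> (g *m c) i 0 = 0].
Proof.
move=> can c_neq0.
have [l cl] : exists l, c l 0 != 0.
  apply/existsP; apply: contraNT c_neq0 => /existsPn c0.
  by apply/eqP/colP=> l; rewrite mxE; apply/eqP; have := c0 l; rewrite negbK.
case: (@arg_maxnP _ l (fun l => c l 0 != 0) (fun l => nat_of_ord (w l)) cl) => m cm mmax.
exists m; split=> // [|i ltmi]; rewrite mxE.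
  rewrite (bigD1 m) //= big1 ?addr0; first by have [-> _ _] := can m; rewrite mul1r.
  move=> k nkm; have [->|ck] := eqVneq (c k 0) 0; first by rewrite mulr0.
  have [_ can0 _] := can k; rewrite can0 ?mul0r //.
  rewrite ltn_neqAle (mmax k ck : (w k <= w m)%N) andbT.
  by apply: contra nkm => /eqP/val_inj/perm_inj->.
apply: big1 => k _; have [->|ck] := eqVneq (c k 0) 0; first by rewrite mulr0.
have [_ can0 _] := can k; rewrite can0 ?mul0r //.
exact: leq_ltn_trans (mmax k ck) ltmi.
Qed.

Lemma canonical_rep_mulmx0 w g c : canonical_rep w g ->
  (forall l, c l 0 != 0 -> (g *m c) (w l) 0 = 0) -> c = 0.
Proof.
move=> can gc0; apply/eqP/negPn/negP => /(canonical_rep_leading can)[l [cl gcl _]].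
by move: (cl); rewrite -gcl gc0 // eqxx.
Qed.

Lemma canonical_rep_unitmx w g : canonical_rep w g -> g \in unitmx.
Proof.
move=> can; rewrite -unitmx_tr -row_free_unit; apply: inj_row_free => v vg0.
have gv0 : g *m v^T = 0 by rewrite -[g]trmxK -trmx_mul vg0 trmx0.
apply: trmx_inj; rewrite trmx0; apply: (canonical_rep_mulmx0 can) => l _.
by rewrite gv0 mxE.
Qed.

Lemma flag_of_eq0 w g j x : canonical_rep w g -> x \in flag_of g j ->
  (forall l, (l <= j)%N -> x (w l) 0 = 0) -> x = 0.
Proof.
move=> can /flag_ofP[c c0 ->] gc0.
rewrite (canonical_rep_mulmx0 can (c := c)) ?mulmx0 // => l cl.
by apply: gc0; rewrite leqNgt; apply: contra cl => /c0->.
Qed.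

(** The difference of the two columns [j] lies in V_j and vanishes in the pivot rows of the columns
    up to [j]: both entries are 1 in row [w j], and 0 to the right of an earlier pivot. *)
Lemma canonical_rep_uniq w g g' : canonical_rep w g -> canonical_rep w g' ->
  flag_of g = flag_of g' -> g = g'.
Proof.
move=> can can' eqV; apply/matrixP=> i j.
suff /colP/(_ i) : col j g - col j g' = 0 by rewrite !mxE => /subr0_eq.
apply: (flag_of_eq0 can (j := j)).
  by rewrite rpredB ?flag_of_col // eqV flag_of_col.
move=> l; rewrite leq_eqVlt !mxE => /orP[/eqP/val_inj->|ltlj].
  by have [-> _ _] := can j; have [-> _ _] := can' j; rewrite subrr.
by have [_ _ can0] := can l; have [_ _ can0'] := can' l; rewrite can0 ?can0' ?subrr.
Qed.

(** Since the flag is nested, the images of the earlier columns already lie in V_j, and only the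
    last column has to be tested. *)
Lemma springer_flag_of n g : springer_fiber F N n (flag_of g) <->
  is_flag (flag_of g) /\ forall j, jordan_mx F N n *m col j g \in flag_of g j.
Proof.
split=> -[flagV stab]; split=> // j.
  have := memv_img (linfun (mulmx (jordan_mx F N n))) (flag_of_col g (leqnn j)).
  by move/(subvP (stab j)); rewrite lfunE.
apply/subvP => y /memv_imgP[x xV ->]; rewrite lfunE /=.
have /flag_ofP[c c0 ->] := xV.
rewrite mulmx_col_sum mulmx_sumr; apply: rpred_sum => l _; rewrite -scalemxAr.
have [lelj|/c0->] := leqP l j; last by rewrite scale0r mem0v.
by have [_ /(_ _ _ lelj)/subvP sub] := flagV; rewrite memvZ ?sub.
Qed.

Lemma jordan_mulmxE n p (g : 'M[F]_(N, p)) (i : 'I_N) (j : 'I_p) :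
  (jordan_mx F N n *m g) i j =
  \sum_(l : 'I_N | (l == i.+1 :> nat) && (i.+1 != n)) g l j.
Proof.
rewrite mxE [RHS]big_mkcond; apply: eq_bigr => l _; rewrite mxE.
have [<-|] := eqVneq i.+1 (l : nat); last by rewrite mul0r.
by case: (_ != _); rewrite ?mul1r ?mul0r.
Qed.

End Flags.

(** * Stability of the flags in the cell of a shuffle *)

(** As [w j] is not n, X moves the pivot of column [j] up to row [w i], which becomes the lowest
    nonzero row of X g_j. In a vector of V_j this row is the pivot row of a column up to [j], so [i]
    cannot come after [j]. *)
Lemma springer_canonical_incr (F : fieldType) (N n : nat) (w : 'S_N) (g : 'M[F]_N) :
    canonical_rep w g -> springer_fiber F N n (flag_of g) ->
  forall i j : 'I_N, (w i).+1 = w j -> w j != n :> nat -> (i < j)%N.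
Proof.
move=> can /springer_flag_of[_ stab] i j eqw neqn; rewrite ltnNge; apply/negP => leji.
have neij : j != i by apply/eqP => eij; move: eqw; rewrite eij; lia.
have Xi : (jordan_mx F N n *m col j g) (w i) 0 = 1.
  rewrite jordan_mulmxE (big_pred1 (w j)) => [|l].
    by have [gjj _ _] := can j; rewrite mxE gjj.
  by rewrite eqw neqn andbT.
have Xlow (k : 'I_N) : (w i < k)%N -> (jordan_mx F N n *m col j g) k 0 = 0.
  move=> ltk; rewrite jordan_mulmxE big1 // => l /andP[/eqP el _]; rewrite mxE.
  by have [_ can0 _] := can j; rewrite can0 // -eqw el.
have /flag_ofP[c c0 Xgc] := stab j; rewrite {}Xgc in Xi Xlow.
have [c_eq0|c_neq0] := eqVneq c 0.
  by move: Xi; rewrite c_eq0 mulmx0 mxE => /eqP; rewrite eq_sym oner_eq0.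
have [m [cm gcm gc0]] := canonical_rep_leading can c_neq0.
case: (ltngtP (w m) (w i)) => [ltmi|ltim|/val_inj/perm_inj emi].
- by move: Xi; rewrite gc0 // => /eqP; rewrite eq_sym oner_eq0.
- by move: cm; rewrite -gcm Xlow ?eqxx.
by move: cm; rewrite emi c0 ?eqxx // ltn_neqAle leji andbT neij.
Qed.

Section ShuffleCells.
Variables (F : fieldType) (N : nat) (U : {set 'I_N}) (w : 'S_N).
Hypothesis wE : forall i, w i = shuffle U i :> nat.
Implicit Types (g : 'M[F]_N) (i j l : 'I_N) (a : 'I_N -> F) (p r : nat).
Local Notation n := #|U|.

Lemma shuffle_row r : (r < N)%N -> exists l, w l = r :> nat.
Proof. by move=> ltr; exists ((w^-1)%g (Ordinal ltr)); rewrite permKV. Qed.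

Lemma shuffle_lt_low l j : l \in U -> (w l < cnt U j)%N = (l < j)%N.
Proof. by move=> lU; rewrite wE /shuffle lU cnt_lt. Qed.

Lemma shuffle_inU l : (l \in U) = (w l < n)%N.
Proof. by rewrite wE shuffle_lt_card. Qed.

(** The rows above [cnt U j] are the pivot rows of the columns of [U] before [j], and column [j] is
    to the right of these pivots. *)
Lemma canonical_low g i j : canonical_rep w g -> (i < cnt U j)%N -> i != w j ->
  g i j = 0.
Proof.
move=> can lti neq; have [l ewl] := shuffle_row (ltn_ord i).
have lU : l \in U by rewrite shuffle_inU ewl (leq_trans lti) ?cnt_max.
have [_ _ can0] := can l; rewrite (_ : i = w l) ?can0 //; last exact/val_inj.
by rewrite -shuffle_lt_low // ewl.
Qed.

Lemma canonical_upper g i j : canonical_rep w g -> j \in U ->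
  g i j = (i == w j)%:R.
Proof.
move=> can jU; have [gjj gj0 _] := can j.
case: (ltngtP i (w j)) => [lti|lti|/val_inj->]; last by rewrite eqxx.
  have neq : i != w j by apply/eqP => e; rewrite e ltnn in lti.
  rewrite (negbTE neq) canonical_low //; apply: leq_trans lti _.
  by rewrite wE /shuffle jU.
rewrite gj0 //; case: eqP => // e; by rewrite e ltnn in lti.
Qed.

(** The rows from n to the pivot of [j] are pivot rows of earlier columns outside [U]. *)
Lemma canonical_bottom g i j : canonical_rep w g -> j \notin U -> (n <= i)%N ->
  g i j = (i == w j)%:R.
Proof.
move=> can jU len; have [gjj gj0 _] := can j.
case: (ltngtP i (w j)) => [lti|lti|/val_inj->]; last by rewrite eqxx.
  have neq : i != w j by apply/eqP => e; rewrite e ltnn in lti.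
  rewrite (negbTE neq); have [l ewl] := shuffle_row (ltn_ord i).
  have lU : (l \in U) = (j \in U).
    by rewrite (negbTE jU) shuffle_inU ewl ltnNge len.
  have [_ _ can0] := can l; rewrite (_ : i = w l) ?can0 //; last exact/val_inj.
  by rewrite -(shuffle_mono lU) -!wE ewl.
rewrite gj0 //; case: eqP => // e; by rewrite e ltnn in lti.
Qed.

(* The entry of [g] in row [r] of the upper block, extended by 0. *)
Definition entry g r j : F := \sum_(i : 'I_N | (i == r :> nat) && (r < n)%N) g i j.

Lemma entry_ord g i j : (i < n)%N -> entry g i j = g i j.
Proof.
by move=> lti; rewrite /entry lti; under eq_bigl do rewrite andbT; rewrite big_pred1_eq.
Qed.

Lemma entry_out g r j : (n <= r)%N -> entry g r j = 0.
Proof. by move=> len; rewrite /entry big_pred0 // => i; rewrite ltnNge len andbF. Qed.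

(** In row n - 1 both sides are 0, since the first Jordan block ends there. This boundary case is
    what makes diagonals reaching row n vanish. *)
Lemma jordan_entry g i j : (i < n)%N -> (jordan_mx F N n *m col j g) i 0 = entry g i.+1 j.
Proof.
move=> lti; rewrite jordan_mulmxE; apply: eq_big => [l|l _]; last by rewrite mxE.
by rewrite ltn_neqAle lti andbT.
Qed.

(* [diag a p r] is the entry in row [r >= cnt U p] of the last non-upper column
   before [p]: a diagonal of equal entries runs down and to the right from the
   value [a q] in row [cnt U q] of each such column [q], until the next
   diagonal starts. *)
Fixpoint diag a p r : F :=
  if p is q.+1 then
    if insub q is Some i then
      if i \in U then diag a q r
      else if r == cnt U q then a i else diag a q r.-1
    else 0
  else 0.

Lemma diagS a j r : diag a j.+1 r =
  if j \in U then diag a j r else if r == cnt U j then a j else diag a j r.-1.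
Proof. by rewrite /= valK. Qed.

Lemma eq_diag a b p r : (forall j, j \notin U -> a j = b j) -> diag a p r = diag b p r.
Proof.
move=> eqab; elim: p r => //= q IHq r; case: insub => // i.
by case: (boolP (i \in U)) => // iU; rewrite !IHq eqab.
Qed.

(** Columns of [U] leave [diag] unchanged, so only the last column outside [U] before [p]
    matters. *)
Lemma diag_prev p : (p <= N)%N ->
  (cnt (~: U) p = 0%N /\ forall a r, diag a p r = 0) \/
  exists l, [/\ l \notin U, (l < p)%N, cnt (~: U) p = (cnt (~: U) l).+1
              & forall a r, diag a p r = diag a l.+1 r].
Proof.
move: p; apply: leq_ord_ind => [|i IH]; first by left; rewrite cnt0.
have [iU|iU] := boolP (i \in U); last first.
  by right; exists i; rewrite cntS in_setC iU.
case: IH => [[ci di]|[l [lU ltli cl dl]]].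
  by left; split=> [|a r]; rewrite ?cntS ?diagS ?in_setC ?iU.
right; exists l; split=> [||| a r] //; first exact: ltnW.
  by rewrite cntS in_setC iU.
by rewrite diagS iU dl.
Qed.

(** The first [cnt U j] basis vectors are themselves columns of [g], namely those of [U] before
    [j]. *)
Lemma low_in_flag g j (x : 'cV[F]_N) : canonical_rep w g ->
  (forall i, (cnt U j <= i)%N -> x i 0 = 0) -> x \in flag_of g j.
Proof.
move=> can x0.
(* The coefficients are simply the entries of [x] in the pivot rows, because every column with a
   nonzero coefficient is a basis vector. *)
have -> : x = \sum_l x (w l) 0 *: col l g.
  apply/colP=> i; rewrite summxE.
  have [l ewl] := shuffle_row (ltn_ord i); have ewl' : w l = i by exact/val_inj.
  rewrite (bigD1 l) //= big1 ?addr0.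
    by rewrite !mxE ewl' -ewl'; have [-> _ _] := can l; rewrite mulr1.
  move=> k nkl; rewrite !mxE; have [lek|ltk] := leqP (cnt U j) (w k).
    by rewrite x0 ?mul0r.
  rewrite canonical_upper -?ewl' ?(inj_eq perm_inj) ?(negbTE nkl) ?mulr0 //.
    by rewrite eq_sym (negbTE nkl) mulr0.
  by rewrite shuffle_inU (leq_trans ltk) ?cnt_max.
apply: rpred_sum => l _; have [lelj|ltjl] := leqP l j.
  by apply: rpredZ; exact: flag_of_col.
rewrite x0 ?scale0r ?mem0v // leqNgt; apply/negP => ltw.
have lU : l \in U by rewrite shuffle_inU (leq_trans ltw) ?cnt_max.
by move: ltw; rewrite shuffle_lt_low // ltnNge ltnW.
Qed.

Lemma in_flag_bottom g j (x : 'cV[F]_N) : canonical_rep w g -> j \notin U ->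
  (forall i, (n <= i)%N -> x i 0 = 0) ->
  (x \in flag_of g j) <-> (forall i, (cnt U j <= i)%N -> x i 0 = 0).
Proof.
move=> can jU xn0; split=> [xV i lei|]; last exact: low_in_flag.
(* Removing the top part [y], which lies in V_j, leaves a vector of V_j that vanishes in the pivot
   rows of all columns up to [j], hence 0. *)
pose y : 'cV[F]_N := \col_i (if (i < cnt U j)%N then x i 0 else 0).
have yV : y \in flag_of g j.
  by apply: low_in_flag => // k lek; rewrite mxE ltnNge lek.
have : x - y = 0.
  apply: (flag_of_eq0 can (j := j)) => [|l lelj]; first exact: rpredB.
  rewrite !mxE; case: ltnP => lew; first by rewrite subrr.
  rewrite subr0 xn0 // leqNgt -shuffle_inU; apply/negP => lU.
  have : (l < j)%N by rewrite ltn_neqAle lelj andbT; apply: contra jU => /eqP/val_inj<-.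
  by rewrite -shuffle_lt_low // ltnNge lew.
by move/colP/(_ i); rewrite !mxE ltnNge lei subr0.
Qed.

Lemma shift_bottom g j (i : 'I_N) : canonical_rep w g -> j \notin U -> (n <= i)%N ->
  (jordan_mx F N n *m col j g) i 0 = (i.+1 == w j)%:R.
Proof.
move=> can jU len; rewrite jordan_mulmxE.
have -> : i.+1 != n by rewrite neq_ltn ltnS len orbT.
under eq_bigl do rewrite andbT.
have [ltiN|leNi] := ltnP i.+1 N.
  rewrite (big_pred1 (Ordinal ltiN)) => [|l]; last by [].
  by rewrite mxE canonical_bottom //= ltnW.
rewrite big1 => [|l /eqP el]; last by have := ltn_ord l; rewrite el ltnNge leNi.
case: eqP => // e; by have := ltn_ord (w j); rewrite -e ltnNge leNi.
Qed.

(** The pivot of the first column outside [U] is in row n, where X kills it; X g_j then lives in the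
    upper block. *)
Lemma shift_in_flag_first g j : canonical_rep w g -> j \notin U ->
    cnt (~: U) j = 0%N ->
  jordan_mx F N n *m col j g \in flag_of g j <->
  (forall i : 'I_N, (cnt U j <= i < n)%N -> entry g i.+1 j = 0).
Proof.
move=> can jU cj0.
have bot (i : 'I_N) : (n <= i)%N -> (jordan_mx F N n *m col j g) i 0 = 0.
  move=> len; rewrite shift_bottom //; case: eqP => // e.
  by have := wE j; rewrite /shuffle (negbTE jU) cj0 -e; lia.
rewrite in_flag_bottom //; split=> x0 i.
  by case/andP=> lei lti; rewrite -jordan_entry ?x0.
move=> lei; have [lti|/bot//] := ltnP i n.
by rewrite jordan_entry // x0 ?lei.
Qed.

(** Subtracting the previous column [l] outside [U], which lies in V_j, cancels the shifted pivot
    and leaves a vector of the upper block. *)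
Lemma shift_in_flag_next g j l : canonical_rep w g -> j \notin U -> l \notin U ->
    (l < j)%N -> cnt (~: U) j = (cnt (~: U) l).+1 ->
  jordan_mx F N n *m col j g \in flag_of g j <->
  (forall i : 'I_N, (cnt U j <= i < n)%N -> entry g i.+1 j = entry g i l).
Proof.
move=> can jU lU ltlj cj; set x := _ *m _.
have ewj : w j = (w l).+1 :> nat by rewrite !wE /shuffle (negbTE jU) (negbTE lU) cj addnS.
have -> : (x \in flag_of g j) = (x - col l g \in flag_of g j).
  by rewrite rpredBr // flag_of_col // ltnW.
have bot (i : 'I_N) : (n <= i)%N -> (x - col l g) i 0 = 0.
  move=> len; rewrite mxE shift_bottom // [X in _ + X]mxE [X in _ - X]mxE canonical_bottom //.
  by rewrite ewj eqSS subrr.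
have ent (i : 'I_N) : (i < n)%N -> (x - col l g) i 0 = entry g i.+1 j - entry g i l.
  by move=> lti; rewrite mxE jordan_entry // [X in _ + X]mxE [X in _ - X]mxE entry_ord.
rewrite in_flag_bottom //; split=> x0 i.
  by case/andP=> lei lti; apply/subr0_eq; rewrite -ent ?x0.
move=> lei; have [lti|/bot//] := ltnP i n.
by rewrite ent // x0 ?lei ?subrr.
Qed.

(** Strong induction on the columns: stability of V_j makes each entry of column [j] below row
    [cnt U j] a copy of the one up and to the left in the previous column outside [U]. *)
Lemma springer_entryP g : canonical_rep w g ->
  springer_fiber F N n (flag_of g) <->
  (forall j r, j \notin U -> (cnt U j <= r)%N ->
     entry g r j = diag (fun l => entry g (cnt U l) l) j.+1 r).
Proof.
move=> can; set a := fun l => _.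
have eq_diag_entry j : j \notin U ->
    (forall l r, l \notin U -> (l < j)%N -> (cnt U l <= r)%N ->
      entry g r l = diag a l.+1 r) ->
    jordan_mx F N n *m col j g \in flag_of g j <->
    (forall i : 'I_N, (cnt U j <= i < n)%N -> entry g i.+1 j = diag a j i).
  move=> jU IH; case: (diag_prev (ltnW (ltn_ord j))) => [[cj dj]|[l [lU ltlj cj dj]]].
    by rewrite shift_in_flag_first //; split=> ent i /ent->; rewrite dj.
  rewrite (shift_in_flag_next can jU lU ltlj cj); split=> ent i /andP[lei lti];
    by rewrite ent ?lei // dj IH // (leq_trans _ lei) // leq_cnt // ltnW.
rewrite springer_flag_of; split=> [[_ stab] j r jU|ent].
  have [k] := ubnP (nat_of_ord j); elim: k j r jU => // k IH j r jU ltjk ler.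
  have IHj l r' : l \notin U -> (l < j)%N -> (cnt U l <= r')%N ->
      entry g r' l = diag a l.+1 r'.
    by move=> lU ltlj; apply: IH => //; rewrite -ltnS (leq_trans _ ltjk).
  have /(eq_diag_entry j jU IHj) ent := stab j.
  rewrite diagS (negbTE jU); case: eqP => [-> //|/eqP neq].
  case: r neq ler => [|r neq ler]; first by rewrite leqn0 eq_sym => /negbTE->.
  have {neq ler} ler : (cnt U j <= r)%N by rewrite -ltnS ltn_neqAle eq_sym neq.
  have [ltrn|lenr] := ltnP r n.
    have [i ei] : exists i : 'I_N, i = r :> nat.
      have ltrN : (r < N)%N by apply: leq_trans ltrn _; rewrite -[X in (_ <= X)%N]card_ord max_card.
      by exists (Ordinal ltrN).
    by rewrite -ei ent ?ei ?ler.
  (* From row n + 1 on, stability says nothing: both sides are 0, the right one because the previous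
     column has no entry in row [r] of the upper block. *)
  rewrite entry_out ?(leqW lenr) //=.
  case: (diag_prev (ltnW (ltn_ord j))) => [[_ ->]//|[l [lU ltlj _ ->]]].
  rewrite -IHj ?entry_out //; apply: leq_trans ler; exact/leq_cnt/ltnW.
split; first exact/flag_of_is_flag/canonical_rep_unitmx.
(* A column of [U] is the basis vector of row [cnt U j]; X kills it or moves it one row up, into the
   span given by [low_in_flag]. *)
move=> j; have [jU|jU] := boolP (j \in U).
  apply: low_in_flag => // i lei; rewrite jordan_mulmxE big1 // => l /andP[/eqP el _].
  rewrite mxE canonical_upper //; case: eqP => // e; move: el; rewrite e wE /shuffle jU.
  lia.
apply/eq_diag_entry => // [l r lU _|i /andP[lei _]]; first exact: ent.
rewrite ent ?(leqW lei) // diagS (negbTE jU) -[i.+1 == _]negbK.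
by rewrite (_ : i.+1 != _) //; apply/eqP; lia.
Qed.

(** This is the only constraint that stability puts on the initial values of the diagonals. *)
Lemma springer_diag_out g : canonical_rep w g -> springer_fiber F N n (flag_of g) ->
  forall p r, (p <= N)%N -> (n <= r)%N -> diag (fun l => entry g (cnt U l) l) p r = 0.
Proof.
move=> can /springer_entryP-/(_ can) ent p r /diag_prev[[_ ->] //|[l [lU _ _ ->]]] len.
by rewrite -ent ?entry_out // (leq_trans _ len) ?cnt_max.
Qed.

End ShuffleCells.

(** * Standard noncrossing matchings *)

Section MatchingCombinatorics.
Local Open Scope nat_scope.
Variables (N n : nat) (M : {set 'I_N * 'I_N}).
Hypothesis admM : admissible n M.
Implicit Types (i j : 'I_N) (p r : nat) (a b c : 'I_N * 'I_N) (al be ga : arc_of M).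
Local Notation k := #|M|.

Lemma arc_lt a : a \in M -> a.1 < a.2.
Proof. by move: admM => /and5P[/andP[/forall_inP H _] _ _ _ _] /H. Qed.

Lemma arc_disjoint a b : a \in M -> b \in M -> a != b ->
  [&& a.1 != b.1 :> nat, a.1 != b.2 :> nat, a.2 != b.1 :> nat & a.2 != b.2 :> nat].
Proof.
move: admM => /and5P[/andP[_ /forall_inP H] _ _ _ _] aM bM.
by have /forall_inP/(_ b bM)/implyP := H a aM; apply.
Qed.

Lemma arc_init_inj a b : a \in M -> b \in M -> a.1 = b.1 -> a = b.
Proof.
move=> aM bM e; apply/eqP; apply: contraTT isT => /(arc_disjoint aM bM).
by rewrite e eqxx.
Qed.

Lemma arc_term_inj a b : a \in M -> b \in M -> a.2 = b.2 -> a = b.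
Proof.
move=> aM bM e; apply/eqP; apply: contraTT isT => /(arc_disjoint aM bM).
by rewrite e eqxx !andbF.
Qed.

Lemma arc_init_term a b : a \in M -> b \in M -> a.1 != b.2.
Proof.
move=> aM bM; have [<-|/(arc_disjoint aM bM)/and4P[]//] := eqVneq a b.
by apply/eqP => e; have := arc_lt aM; rewrite e ltnn.
Qed.

Lemma arc_noncrossing a b : a \in M -> b \in M ->
  b.1 < a.1 -> a.1 < b.2 -> a.2 < b.2.
Proof.
move=> aM bM lt11 lt12; move: admM => /and5P[_ /forall_inP/(_ a aM) + _ _ _].
move=> /forall_inP/(_ b bM); rewrite lt11 lt12 /= -leqNgt leq_eqVlt => /orP[/eqP e|//].
by have := arc_term_inj aM bM (val_inj e) => eab; rewrite eab ltnn in lt11.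
Qed.

Lemma arc_standard a i : a \in M -> i \in unmatched M -> ~~ (a.1 < i < a.2).
Proof.
move=> aM; rewrite in_setC; apply: contra => lti.
move: admM => /and5P[_ _ /forall_inP/(_ a aM)/forallP/(_ i)/implyP + _ _].
exact.
Qed.

Lemma startsP i : reflect (exists al : arc_of M, (val al).1 = i) (i \in starts M).
Proof.
apply: (iffP imsetP) => [[a aM ->]|[al <-]]; first by exists (exist _ a aM).
by exists (val al) => //; exact: (valP al).
Qed.

Lemma endsP i : reflect (exists al : arc_of M, (val al).2 = i) (i \in ends M).
Proof.
apply: (iffP imsetP) => [[a aM ->]|[al <-]]; first by exists (exist _ a aM).
by exists (val al) => //; exact: (valP al).
Qed.

Lemma starts_notin_ends i : i \in starts M -> i \notin ends M.
Proof.
case/startsP=> al <-; apply/endsP => -[be e].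
by have := arc_init_term (valP al) (valP be); rewrite e eqxx.
Qed.

Lemma card_starts : #|starts M| = k.
Proof. by apply: card_in_imset => a b aM bM; exact: arc_init_inj. Qed.

Lemma card_ends : #|ends M| = k.
Proof. by apply: card_in_imset => a b aM bM; exact: arc_term_inj. Qed.

Lemma leq_k_n : k <= n.
Proof. by rewrite -card_starts; case/and5P: admM. Qed.

Lemma leq_k_Nn : k <= N - n.
Proof. by rewrite -card_ends; case/and5P: admM. Qed.

Lemma cnt_trichotomy p : p <= N ->
  cnt (starts M) p + cnt (ends M) p + cnt (unmatched M) p = p.
Proof.
move: p; apply: leq_ord_ind => [|i IH]; first by rewrite !cnt0.
rewrite !cntS !inE; have := @starts_notin_ends i.
by case: (i \in starts M) => /= => [/(_ isT)/negbTE->|_]; case: (i \in ends M) => /=; lia.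
Qed.

(** The columns whose pivot in w_M lies in the first n rows: [matching_perm] is the shuffle of this
    set. *)
Definition upper : {set 'I_N} :=
  ends M :|: [set i in unmatched M | Jnot M i < n - k].

Lemma upper_starts i : i \in starts M -> i \notin upper.
Proof.
move=> iS; rewrite !inE negb_or (starts_notin_ends iS) /=.
by rewrite iS.
Qed.

Lemma upper_ends i : i \in ends M -> i \in upper.
Proof. by rewrite !inE => ->. Qed.

Lemma upper_unmatched i : i \in unmatched M -> (i \in upper) = (Jnot M i < n - k).
Proof.
rewrite !inE => iN; rewrite iN; move: iN; rewrite negb_or => /andP[_ /negbTE->].
by [].
Qed.

Lemma cnt_upper p : p <= N ->
  cnt upper p = cnt (ends M) p + minn (cnt (unmatched M) p) (n - k).
Proof.
move: p; apply: leq_ord_ind => [|i IH]; first by rewrite !cnt0 min0n.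
rewrite !cntS {}IH.
have [iN|iN] := boolP (i \in unmatched M).
  have iE : i \notin ends M by move: iN; rewrite !inE negb_or => /andP[].
  rewrite upper_unmatched // (negbTE iE).
  by rewrite /Jnot -[#|_|]/(cnt _ _); case: ltnP => /=; lia.
have /orP[iS|iE] : (i \in starts M) || (i \in ends M).
  by move: iN; rewrite !inE negbK.
  by rewrite (negbTE (upper_starts iS)) (negbTE (starts_notin_ends iS)).
by rewrite upper_ends // iE.
Qed.

Lemma cnt_lower p : p <= N ->
  cnt (~: upper) p = cnt (starts M) p + (cnt (unmatched M) p - (n - k)).
Proof.
move=> lep; have := cnt_setC upper lep; rewrite cnt_upper //.
have := cnt_trichotomy lep; lia.
Qed.

(** Thus f_M adds entries from the first row below the pivots of the earlier columns of [upper]. *)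
Lemma row0E i : Defs.row0 n M i = cnt upper i.
Proof. by rewrite cnt_upper // ltnW. Qed.

(* The arcs (a, b) with a < p <= b, the innermost one first. *)
Fixpoint open_arcs p : seq (arc_of M) :=
  if p is q.+1 then
    if insub q is Some i then
      if [pick al : arc_of M | (val al).1 == i] is Some al then al :: open_arcs q
      else if i \in ends M then behead (open_arcs q) else open_arcs q
    else open_arcs q
  else [::].

Lemma open_arcs_start al : open_arcs (val al).1.+1 = al :: open_arcs (val al).1.
Proof.
rewrite /= valK; case: pickP => [be /eqP e|/(_ al)]; last by rewrite eqxx.
by have -> : be = al by exact/val_inj/(arc_init_inj (valP be) (valP al)).
Qed.

Lemma open_arcs_notstart i : i \notin starts M ->
  open_arcs i.+1 = if i \in ends M then behead (open_arcs i) else open_arcs i.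
Proof.
move=> iS; rewrite /= valK; case: pickP => [be /eqP e|//].
by case/startsP: iS; exists be.
Qed.

(** [open_arcs] is a stack: its tail is the stack at the moment when its head was pushed. Membership
    needs this, and strong induction, to see that an arc end pops the right arc. *)
Lemma open_arcsP p : p <= N ->
  (forall al, (al \in open_arcs p) = ((val al).1 < p <= (val al).2)) /\
  (forall al s, open_arcs p = al :: s -> s = open_arcs (val al).1).
Proof.
have [m] := ubnP p; elim: m p => // m IH [|p] ltpm lepN.
  by split=> [al|//]; rewrite ltn0.
have IHp q : q <= p -> (forall al, (al \in open_arcs q) = ((val al).1 < q <= (val al).2)) /\
  (forall al s, open_arcs q = al :: s -> s = open_arcs (val al).1).
  by move=> leqp; apply: IH; lia.
have [i ei] : exists i, i = p :> nat by exists (Ordinal lepN).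
have [memp tailp] := IHp p (leqnn p).
have [/startsP[al eal]|iS] := boolP (i \in starts M).
  rewrite -ei -eal open_arcs_start eal ei; split=> [be|be s [<- <-]]; last by rewrite eal ei.
  rewrite inE memp; have [->|neq] := eqVneq be al.
    by rewrite eal ei ltnSn; have := arc_lt (valP al); rewrite eal ei => ->.
  have := arc_disjoint (valP be) (valP al); rewrite (inj_eq val_inj) => /(_ neq).
  rewrite eal ei => /and4P[]; lia.
rewrite -ei open_arcs_notstart // ei.
have notstart be : (val be).1 != p :> nat.
  rewrite -ei; apply: contra iS => /eqP/val_inj e; apply/startsP; by exists be.
have [/endsP[al eal]|iE] := boolP (i \in ends M).
  have alp : al \in open_arcs p.
    by rewrite memp -ei -eal leqnn andbT arc_lt ?(valP al).
  case eqs : (open_arcs p) (alp) => [//|be s] _; have es := tailp _ _ eqs.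
  have bep : be \in open_arcs p by rewrite eqs mem_head.
  move: bep; rewrite memp => /andP[ltbe lebe].
  have [mems tails] := IHp _ (ltnW ltbe).
  (* Otherwise [al] was open when the head [be] started, and noncrossing makes [be] end before [al],
     that is before [p], though it is still open. *)
  have ebe : be = al.
    apply/eqP; apply: contraTT isT => neq.
    have : al \in s by move: alp; rewrite eqs inE eq_sym (negbTE neq).
    rewrite es mems => /andP[ltal leal].
    have := arc_disjoint (valP be) (valP al); rewrite (inj_eq val_inj) => /(_ neq).
    have := arc_noncrossing (valP be) (valP al) ltal.
    rewrite eal ei => + /and4P[_ _ _]; lia.
  rewrite -ebe in eal; rewrite [behead _]/=; split=> [ga|]; last by rewrite es.
  have := memp ga; rewrite es eqs es inE mems.
  have [->|neq] := eqVneq ga be; first by rewrite eal ei; lia.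
  rewrite orFb => ->.
  have := arc_disjoint (valP ga) (valP be); rewrite (inj_eq val_inj) => /(_ neq).
  rewrite eal ei => /and4P[_ _ _]; have := notstart ga; lia.
split=> // be; rewrite memp; have := notstart be.
have : (val be).2 != p :> nat.
  by rewrite -ei; apply: contra iE => /eqP/val_inj e; apply/endsP; exists be.
lia.
Qed.

Lemma mem_open_arcs p al : p <= N -> (al \in open_arcs p) = ((val al).1 < p <= (val al).2).
Proof. by case/open_arcsP. Qed.

Lemma open_arcs_tail p al s : p <= N -> open_arcs p = al :: s -> s = open_arcs (val al).1.
Proof. by case/open_arcsP=> _; apply. Qed.

Lemma open_arcs_unmatched i : i \in unmatched M -> open_arcs i = [::].
Proof.
move=> iN; case eqs: (open_arcs i) => [//|al s].
have : al \in open_arcs i by rewrite eqs mem_head.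
rewrite mem_open_arcs ?(ltnW (ltn_ord i)) // => /andP[lti lei].
have := arc_standard (valP al) iN; rewrite lti andTb -leqNgt => gei.
have ei : (val al).2 = i by apply: ord_inj; lia.
by move: iN; rewrite !inE negb_or => /andP[_ /endsP[]]; exists al.
Qed.

(** By noncrossing, the arcs open where [al] starts are those nested above it, and the head has the
    largest start. *)
Lemma ohead_open_arcs al : parent al = ohead (open_arcs (val al).1).
Proof.
have leN i : i <= N by exact: ltnW.
have nested be : nested_above be al = (be \in open_arcs (val al).1).
  rewrite mem_open_arcs //; apply/andP/andP => -[lt1 lt2]; split=> //.
    exact/ltnW/(ltn_trans (arc_lt (valP al))).
  apply: arc_noncrossing (valP al) (valP be) lt1 _; rewrite ltn_neqAle lt2 andbT.
  exact: (arc_init_term (valP al) (valP be)).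
rewrite /parent; case: pickP => [be|].
  rewrite nested => /andP[bein /forallP bemax].
  case eqs : (open_arcs _) (bein) => [//|ga s] _ /=; congr Some.
  have := bemax ga; rewrite nested eqs mem_head => /= lega.
  move: bein; rewrite eqs inE => /orP[/eqP//|].
  rewrite (open_arcs_tail _ eqs) // mem_open_arcs // => /andP[+ _].
  by rewrite ltnNge lega.
case eqs : (open_arcs _) => [//|ga s] /(_ ga).
rewrite nested eqs mem_head /= => /forallP[] be; apply/implyP.
rewrite nested eqs inE => /orP[/eqP->//|].
by rewrite (open_arcs_tail _ eqs) // mem_open_arcs // => /andP[/ltnW].
Qed.

(** The ancestors of [al] form the stack just after [al] opens; past its end, [onth] gives [None],
    which stands for the arc 0. *)
Lemma anc_open_arcs r al : anc r al = onth (open_arcs (val al).1.+1) r.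
Proof.
rewrite open_arcs_start; elim: r al => // r IH al.
rewrite /anc iterSr /= ohead_open_arcs.
case eqs : (open_arcs _) => [|be s] /=; last first.
  by rewrite (open_arcs_tail _ eqs) ?(ltnW (ltn_ord _)) // -IH.
by rewrite onth0n; elim: r {IH} => //= r ->.
Qed.

(* After an unmatched column outside [upper], each column of [upper] closes an
   arc opened after that column. *)
Lemma open_arcs_low j p : j \in unmatched M -> j \notin upper -> j < p <= N ->
  cnt upper p + size (open_arcs p) <= cnt upper j + (cnt (~: upper) p - (cnt (~: upper) j).+1).
Proof.
move=> jN jU /andP[ltjp leN]; move: leN ltjp; move: p; apply: leq_ord_ind => // i IH.
rewrite ltnS leq_eqVlt => /orP[/eqP/val_inj<-|ltji].
  rewrite open_arcs_notstart; last by move: jN; rewrite !inE negb_or => /andP[].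
  by rewrite (open_arcs_unmatched jN) if_same !cntS in_setC (negbTE jU) /=; lia.
have : cnt (~: upper) j < cnt (~: upper) i by rewrite cnt_lt ?in_setC.
move/(_ ltji): IH.
have [iS|iS] := boolP (i \in starts M).
  have iU := upper_starts iS; rewrite !cntS in_setC (negbTE iU).
  by case/startsP: iS => al <-; rewrite open_arcs_start /=; lia.
rewrite open_arcs_notstart // !cntS in_setC; have [iE|iE] := ifPn.
  have [al eal] := endsP _ iE.
  rewrite upper_ends // size_behead.
  have : al \in open_arcs i.
    by rewrite mem_open_arcs ?(ltnW (ltn_ord i)) // eal leqnn andbT -eal arc_lt ?(valP al).
  by case: (open_arcs i) => //= _ s _; lia.
have iN : i \in unmatched M by rewrite !inE negb_or iS iE.
(* [Jnot] is nondecreasing, so the unmatched columns after [j] are outside [upper] as well. *)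
suff -> : i \in upper = false by rewrite /=; lia.
apply/negbTE; move: jU; rewrite !upper_unmatched // -!leqNgt => /leq_trans; apply.
by apply: leq_cnt; exact: ltnW.
Qed.

Hypothesis leqnN : n <= N.

(** From k <= N - n, there are N - 2k >= n - k unmatched columns, so [upper] consists of k ends and
    exactly n - k unmatched columns. *)
Lemma card_upper : #|upper| = n.
Proof.
rewrite -cntN cnt_upper // cntN card_ends.
have := cnt_trichotomy (leqnn N); rewrite !cntN card_starts card_ends.
have := leq_k_n; have := leq_k_Nn; lia.
Qed.

Lemma matching_permE i : matching_perm n M i = shuffle upper i.
Proof.
have leiN := ltnW (ltn_ord i).
rewrite /matching_perm /shuffle card_upper cnt_upper // cnt_lower //.
rewrite -[Jbeg M i]/(cnt (starts M) i) -[Jend M i]/(cnt (ends M) i).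
rewrite -[Jnot M i]/(cnt (unmatched M) i).
have [iS|iS] := ifPn; first by rewrite (negbTE (upper_starts iS)) addnA.
have [iE|iE] := ifPn; first by rewrite upper_ends.
have iN : i \in unmatched M by rewrite !inE negb_or iS iE.
rewrite upper_unmatched // -[Jnot M i]/(cnt (unmatched M) i).
by case: ltnP => _; rewrite ?addnA.
Qed.

(** Each open arc still has to close in one of the n columns of [upper]. The induction runs down
    from N, where no arc is open. *)
Lemma size_open_arcs p : p <= N -> size (open_arcs p) + cnt upper p <= n.
Proof.
move=> leN; rewrite -(subKn leN); move: (N - p) (leq_subr p N) => q {leN p}.
elim: q => [_|q IH ltqN].
  rewrite subn0 cntN card_upper; case eqs: (open_arcs N) => [|al s] //.
  have : al \in open_arcs N by rewrite eqs mem_head.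
  by rewrite mem_open_arcs // => /andP[_]; rewrite leqNgt ltn_ord.
have ltN : N - q.+1 < N by lia.
pose i := Ordinal ltN; move/(_ (ltnW ltqN)): IH.
have -> : N - q = i.+1 by rewrite /=; lia.
rewrite -[N - q.+1]/(nat_of_ord i); move: i => i.
have [iS|iS] := boolP (i \in starts M).
  rewrite cntS (negbTE (upper_starts iS)); case/startsP: iS => al <-.
  by rewrite open_arcs_start /=; lia.
rewrite open_arcs_notstart // cntS; have [iE|iE] := ifPn.
  by rewrite upper_ends // size_behead; lia.
have iN : i \in unmatched M by rewrite !inE negb_or iS iE.
by rewrite (open_arcs_unmatched iN) /=; lia.
Qed.

End MatchingCombinatorics.

(** * The matching of a shuffle *)

Section MatchingOfShuffle.
Local Open Scope nat_scope.
Variables (N : nat) (U : {set 'I_N}).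
Implicit Types (i j c : 'I_N) (p q : nat).

(* The height of the lattice path going down in the columns of U and up in the
   others, shifted by N to remain nonnegative. *)
Definition height p : nat := N + cnt (~: U) p - cnt U p.

Lemma heightS i : height i.+1 = if i \in U then (height i).-1 else (height i).+1.
Proof.
have := cnt_setC U (ltn_ord i); have := ltn_ord i.
by rewrite /height !cntS in_setC; case: (i \in U) => /=; lia.
Qed.

Lemma height_gt0 i : 0 < height i.
Proof. by have := cnt_setC U (ltnW (ltn_ord i)); have := ltn_ord i; rewrite /height; lia. Qed.

(** Parenthesis matching: step [a.2] is the one by which the path first returns to its level before
    step [a.1]. *)
Definition height_matching : {set 'I_N * 'I_N} :=
  [set a : 'I_N * 'I_N | [&& a.1 < a.2, height a.2.+1 == height a.1
     & [forall c : 'I_N, (a.1 < c <= a.2) ==> (height a.1 < height c)]]].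
Local Notation M := height_matching.

Lemma height_matchingP (a : 'I_N * 'I_N) : reflect
  [/\ a.1 < a.2, height a.2.+1 = height a.1
    & forall p, a.1 < p <= a.2 -> height a.1 < height p] (a \in M).
Proof.
rewrite inE; apply: (iffP and3P) => -[lt eqh gth]; split=> //; try exact/eqP.
  move=> p /andP[ltp lep]; have ltpN := leq_ltn_trans lep (ltn_ord a.2).
  by have /forallP/(_ (Ordinal ltpN))/implyP := gth; apply; rewrite /= ltp.
by apply/forallP=> c; apply/implyP; exact: gth.
Qed.

Lemma height_matching_upper a : a \in M -> (a.1 \notin U) /\ (a.2 \in U).
Proof.
move=> /height_matchingP[lt eqh gth]; split.
  have := gth a.1.+1; rewrite ltnSn lt => /(_ isT).
  by rewrite heightS; case: (a.1 \in U) => //; rewrite ltnNge leq_pred.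
have := gth a.2; rewrite lt leqnn => /(_ isT).
by rewrite -eqh heightS; case: (a.2 \in U) => //; rewrite ltnNge leqnSn.
Qed.

(* Discrete intermediate values: the first return to a level and the last visit
   to it happen with a unit step. *)
Lemma height_first i p : i \notin U -> i < p <= N -> height p <= height i ->
  exists2 b : 'I_N, b < p & (i, b) \in M.
Proof.
move=> iU /andP[ltip lepN] leh.
have ex : exists q, (i < q) && (height q <= height i) by exists p; rewrite ltip.
have [q /andP[ltiq leq] qmin] := ex_minnP ex.
have leqp : q <= p by apply: qmin; rewrite ltip.
case: q ltiq leq qmin leqp => // q ltiq leq qmin leqp.
have ltqN : q < N by lia.
have [b eb] : exists b : 'I_N, b = q :> nat by exists (Ordinal ltqN).
have gth r : i < r <= q -> height i < height r.
  move=> /andP[ltir lerq]; rewrite ltnNge; apply/negP => ler.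
  by have := qmin r; rewrite ltir ler => /(_ isT); lia.
have ltiq' : i < q.
  rewrite ltn_neqAle -ltnS ltiq andbT; apply/eqP => eiq.
  by move: leq; rewrite -eiq heightS (negbTE iU) ltnn.
exists b; first by rewrite eb.
apply/height_matchingP; rewrite /= eb; split=> //.
have := gth q; rewrite ltiq' leqnn => /(_ isT); move: leq; rewrite -eb heightS.
by case: ifP => _; lia.
Qed.

Lemma height_last i p : i \in U -> p <= i -> height p <= height i.+1 ->
  exists2 a : 'I_N, p <= a & (a, i) \in M.
Proof.
move=> iU lepi leh.
pose P q := (q <= i) && (height q <= height i.+1).
have ex : exists q, P q by exists p; rewrite /P lepi.
have bound q : P q -> q <= i by case/andP.
have [q /andP[leqi leq] qmax] := ex_maxnP ex bound.
have lepq : p <= q by apply: qmax; rewrite /P lepi.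
have ltqN := leq_ltn_trans leqi (ltn_ord i).
have [a ea] : exists a : 'I_N, a = q :> nat by exists (Ordinal ltqN).
have gth r : q < r <= i -> height i.+1 < height r.
  move=> /andP[ltqr leri]; rewrite ltnNge; apply/negP => ler.
  by have := qmax r; rewrite /P leri ler => /(_ isT); lia.
have hi : height i.+1 < height i by rewrite heightS iU prednK ?height_gt0.
have ltqi : q < i.
  rewrite ltn_neqAle leqi andbT; apply/eqP => eqi.
  by move: leq hi; rewrite eqi; lia.
have eqh : height q = height i.+1.
  have := gth q.+1; rewrite ltnSn ltqi => /(_ isT); move: leq.
  by rewrite -ea (heightS a); case: ifP => _; lia.
by exists a; [rewrite ea | apply/height_matchingP; rewrite /= ea eqh].
Qed.

(** If [i] came before [j], either the path after [j] is at least as high as at [i], and [j] closes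
    an arc, or it has dropped below that level, and [i] opens one. *)
Lemma height_unmatched i j : i \in unmatched M -> j \in unmatched M ->
  i \notin U -> j \in U -> j < i.
Proof.
move=> iN jN iU jU; case: (ltngtP j i) => // [ltij|/val_inj eij]; last first.
  by rewrite -eij jU in iU.
case: (leqP (height i) (height j.+1)) => leh.
  have [a _ aM] := height_last jU (ltnW ltij) leh.
  by move: jN; rewrite !inE negb_or => /andP[_ /imsetP[]]; exists (a, j).
have [] := @height_first i j.+1 iU; [by rewrite ltnS ltnW //= | exact: ltnW |].
move=> b _ bM; move: iN; rewrite !inE negb_or => /andP[/imsetP[]].
by exists (i, b).
Qed.

Lemma height_matching_admissible : admissible #|U| M.
Proof.
have sS : starts M \subset ~: U.
  by apply/subsetP=> _ /imsetP[a /height_matching_upper[aU _] ->]; rewrite in_setC.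
have sE : ends M \subset U.
  by apply/subsetP=> _ /imsetP[a /height_matching_upper[_ aU] ->].
(* Were [a.2] at least [b.2], the path after [b.2] would be no lower than at [a.1], hence above the
   level of [b], to which it has just returned. *)
have noncross a b : a \in M -> b \in M -> b.1 < a.1 -> a.1 <= b.2 -> a.2 < b.2.
  move=> /height_matchingP[lta eqa gta] /height_matchingP[ltb eqb gtb] lt1 lt2.
  have /gtb : b.1 < a.1 <= b.2 by rewrite lt1.
  rewrite ltnNge => h; rewrite ltnNge; apply: contra h => le2; rewrite -eqb.
  move: le2; rewrite leq_eqVlt => /orP[/eqP->|lt2']; first by rewrite eqa.
  by apply/ltnW/gta; rewrite ltnS lt2.
have inj1 : {in M &, injective (fun a : 'I_N * 'I_N => a.1)}.
  move=> [a1 a2] [b1 b2] /height_matchingP[/= lta eqa gta] /height_matchingP[/= ltb eqb gtb] e1.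
  rewrite -{b1}e1 in ltb eqb gtb *; congr (_, _); case: (ltngtP a2 b2) => [lt|lt|/val_inj //].
    by have := gtb a2.+1; rewrite eqa ltnn ltnS ltnW //= lt => /(_ isT).
  by have := gta b2.+1; rewrite eqb ltnn ltnS ltnW //= lt => /(_ isT).
have inj2 : {in M &, injective (fun a : 'I_N * 'I_N => a.2)}.
  move=> a b aM bM /= e2; apply: inj1 => //.
  have [lta _ _] := height_matchingP _ aM; have [ltb _ _] := height_matchingP _ bM.
  case: (ltngtP a.1 b.1) => [lt|lt|/val_inj //].
    by have := noncross b a bM aM lt; rewrite e2 ltnn (ltnW ltb) => /(_ isT).
  by have := noncross a b aM bM lt; rewrite -e2 ltnn (ltnW lta) => /(_ isT).
have cardE : #|ends M| = #|starts M| by rewrite !card_in_imset.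
apply/and5P; split.
- apply/andP; split; apply/forall_inP => a aM; first by case/height_matchingP: aM.
  apply/forall_inP => b bM; apply/implyP => neq.
  have [a1 a2] := height_matching_upper aM; have [b1 b2] := height_matching_upper bM.
  apply/and4P; split.
  + by apply: contra neq => /eqP e; apply/eqP/inj1.
  + by apply: contraNneq a1 => ->.
  + by apply: contraNneq b1 => <-.
  by apply: contra neq => /eqP e; apply/eqP/inj2.
- apply/forall_inP => a aM; apply/forall_inP => b bM; apply/and3P => -[lt1 lt2 lt3].
  by have := noncross a b aM bM lt1 (ltnW lt2); rewrite ltnNge ltnW.
(* Under an arc [a] the path stays above its level: a down step is matched with an up step from
   [a.1] on, and an up step is matched by [a.2] at the latest. *)
- apply/forall_inP => a aM; apply/forallP => i; apply/implyP => /andP[lta1 lta2].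
  have [lta eqa gta] := height_matchingP _ aM; rewrite in_setU.
  have [iU|iU] := boolP (i \in U); apply/orP; [right|left].
    have [|b _ bM] := @height_last i a.1 iU (ltnW lta1).
      by apply/ltnW/gta; rewrite ltnW.
    by apply/imsetP; exists (b, i).
  have [b _ bM] : exists2 b : 'I_N, b < a.2.+1 & (i, b) \in M.
    apply: height_first => //; first by rewrite ltnS (ltnW lta2) /=.
    by rewrite eqa; apply/ltnW/gta; rewrite lta1 ltnW.
  by apply/imsetP; exists (i, b).
- by rewrite -cardE subset_leq_card.
by have := subset_leq_card sS; have := cardsC U; rewrite cardE card_ord; lia.
Qed.

(** Among the unmatched columns, those of [U] come first, by [height_unmatched], and they number
    [#|U| - #|M|]; these are the ones that [upper] selects. *)
Lemma upper_height_matching : upper #|U| M = U.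
Proof.
have adm := height_matching_admissible.
have sS : starts M \subset ~: U.
  by apply/subsetP=> _ /imsetP[a /height_matching_upper[aU _] ->]; rewrite in_setC.
have sE : ends M \subset U.
  by apply/subsetP=> _ /imsetP[a /height_matching_upper[_ aU] ->].
have unmU : #|unmatched M :&: U| = #|U| - #|M|.
  rewrite -(card_ends adm) -(cardsDS sE); apply: eq_card => i; rewrite !inE.
  have := subsetP sS i; rewrite in_setC.
  by case: (i \in starts M) => [/(_ isT)/negbTE->|]; rewrite ?andbF //.
apply/setP=> i; have [iS|iS] := boolP (i \in starts M).
  by rewrite (negbTE (upper_starts adm iS)); have := subsetP sS i iS; rewrite in_setC => /negbTE.
have [iE|iE] := boolP (i \in ends M); first by rewrite upper_ends ?(subsetP sE).
have iN : i \in unmatched M by rewrite !inE negb_or iS iE.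
rewrite upper_unmatched // -unmU; have [iU|iU] := boolP (i \in U).
  apply: proper_card; rewrite properE; apply/andP; split; apply/subsetP.
    move=> j; rewrite inE => /andP[jN ltji]; rewrite in_setI jN andTb.
    by apply: contraLR ltji => jU; rewrite -leqNgt ltnW // height_unmatched.
  by move/(_ i); rewrite in_setI iN iU => /(_ isT); rewrite inE ltnn andbF.
apply/negbTE; rewrite -leqNgt; apply/subset_leq_card/subsetP => j; rewrite in_setI => /andP[jN jU].
by rewrite inE jN height_unmatched.
Qed.

End MatchingOfShuffle.

(** * The parametrization of a cell *)

Section MatchingCells.
Variables (F : fieldType) (N n : nat) (M : {set 'I_N * 'I_N}) (w : 'S_N).
Hypotheses (leqnN : (n <= N)%N) (admM : admissible n M).
Local Notation U := (upper n M).
Hypothesis wE : forall i, w i = shuffle U i :> nat.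
Implicit Types (i j c : 'I_N) (p r : nat) (al : arc_of M).
Implicit Types (v : {ffun arc_of M -> F}).

(** The sum has at most one term; it serves to give 0 when no arc starts at [i]. *)
Definition init_coord v i : F := \sum_(al : arc_of M | (val al).1 == i) v al.

Lemma sum_init (V : nmodType) (f : arc_of M -> V) al :
  \sum_(be : arc_of M | (val be).1 == (val al).1) f be = f al.
Proof.
apply: big_pred1 => be; apply/eqP/eqP => [|->//].
by move/(arc_init_inj admM (valP be) (valP al))/val_inj.
Qed.

Lemma sum_notinit (V : nmodType) (f : arc_of M -> V) i : i \notin starts M ->
  \sum_(be : arc_of M | (val be).1 == i) f be = 0.
Proof.
move=> iS; apply: big_pred0 => be; apply: contraNF iS => /eqP e.
by apply/startsP; exists be.
Qed.

(** Both sides evolve alike: an arc start pushes a new value, an arc end raises [cnt U] and so drops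
    the top one, and at an unmatched column the stack is empty. *)
Lemma diag_open_arcs v p r : (p <= N)%N -> (cnt U p <= r)%N ->
  diag U (init_coord v) p r = arc_coord v (onth (open_arcs M p) (r - cnt U p)).
Proof.
move=> lep; move: p lep r; apply: leq_ord_ind => [|i IH] r; first by rewrite onth0n.
rewrite diagS cntS; have [iS|iS] := boolP (i \in starts M).
  rewrite (negbTE (upper_starts admM iS)) add0n => ler.
  have /startsP[al eal] := iS.
  have -> : open_arcs M i.+1 = al :: open_arcs M i by rewrite -eal (open_arcs_start admM).
  case: eqP => [->|neq]; first by rewrite subnn /= /init_coord -eal sum_init.
  rewrite IH; last by lia.
  by have -> : (r - cnt U i = (r.-1 - cnt U i).+1)%N by lia.
rewrite open_arcs_notstart //; have [iE|iE] := boolP (i \in ends M).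
  rewrite upper_ends // => ler; rewrite IH; last by lia.
  have -> : (r - cnt U i = (r - (1 + cnt U i)).+1)%N by lia.
  by case: (open_arcs M i) => [|al s] //=; rewrite onth0n.
have iN : i \in unmatched M by rewrite !inE negb_or iS iE.
move=> ler; rewrite (open_arcs_unmatched admM iN) onth0n.
have {}IH r' : (cnt U i <= r')%N -> diag U (init_coord v) i r' = 0.
  by move=> ler'; rewrite IH // (open_arcs_unmatched admM iN) onth0n.
case: ifPn ler => iU ler; first by rewrite IH //; lia.
case: eqP => [_|neq]; first by rewrite /init_coord sum_notinit.
by rewrite IH //; lia.
Qed.

Lemma diag_init_out v p r : (p <= N)%N -> (n <= r)%N -> diag U (init_coord v) p r = 0.
Proof.
move=> lep lenr; have := size_open_arcs admM leqnN lep => lesize.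
by rewrite diag_open_arcs ?onth_default //; lia.
Qed.

Lemma matching_mapE v i c : matching_map n v i c =
  (i == w c)%:R +
  (if (c \in U) || (i < cnt U c)%N then 0 else diag U (init_coord v) c.+1 i).
Proof.
rewrite 3!mxE (matching_permE admM leqnN) -wE; congr (_ + _).
have [cS|cS] := boolP (c \in starts M).
  rewrite (negbTE (upper_starts admM cS)); case/startsP: cS => al <-.
  rewrite sum_init summxE orFb.
  have cntU : cnt U (val al).1.+1 = cnt U (val al).1.
    by rewrite cntS (negbTE (upper_starts admM _)) //; apply/startsP; exists al.
  case: ltnP => lei.
    by rewrite big1 // => j _; rewrite !mxE (row0E admM) eqn_leq [(_ + _ <= _)%N]leqNgt
      (leq_trans lei) ?leq_addr // andbF mulr0.
  rewrite diag_open_arcs ?cntU // -(anc_open_arcs admM) //.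
  (* Only the ancestor of order [i - cnt U (val al).1] contributes to row [i]. *)
  have lt : (i - cnt U (val al).1 < N)%N by apply: leq_ltn_trans (leq_subr _ _) _.
  rewrite (bigD1 (Ordinal lt)) //= big1 ?addr0.
    by rewrite !mxE (row0E admM) subnKC // eqxx mulr1.
  move=> j; rewrite -(inj_eq val_inj) /= => nj; rewrite !mxE (row0E admM).
  case: eqP => [e|]; last by rewrite mulr0.
  by move: nj; rewrite e addKn eqxx.
rewrite sum_notinit // mxE; case: (boolP (c \in U)) => // cU; rewrite orFb; case: ltnP => // lei.
have cE : c \notin ends M by apply: contra cU => /upper_ends.
have cN : c \in unmatched M by rewrite !inE negb_or cS cE.
rewrite diag_open_arcs ?cntS ?(negbTE cU) // open_arcs_notstart // (negbTE cE).
by rewrite (open_arcs_unmatched admM cN) onth0n.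
Qed.

Lemma matching_map_canonical v : canonical_rep w (matching_map n v).
Proof.
have cardU := card_upper admM leqnN.
have UE j : (j \in U) = (w j < n)%N by rewrite (shuffle_inU wE) cardU.
move=> j; split=> [|i ltji|l ltjl]; rewrite matching_mapE.
- rewrite eqxx UE; case: ltnP => [_|lewj]; first by rewrite orTb addr0.
  by rewrite diag_init_out // if_same addr0.
- have -> : (i == w j) = false by apply/eqP => e; rewrite e ltnn in ltji.
  rewrite add0r UE; case: (ltnP (w j) n) => // lewj.
  by rewrite diag_init_out ?if_same // ltnW // (leq_ltn_trans lewj).
have -> : (w j == w l) = false.
  by rewrite (inj_eq perm_inj); apply/eqP => e; rewrite e ltnn in ltjl.
rewrite add0r; case: (ltnP (w j) n) => [ltwj|lewj]; last first.
  by rewrite diag_init_out // if_same.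
by rewrite (shuffle_lt_low wE) ?UE // ltjl orbT.
Qed.

Lemma entry_matching_map v r j : j \notin U -> (cnt U j <= r)%N ->
  entry U (matching_map n v) r j = diag U (init_coord v) j.+1 r.
Proof.
have cardU := card_upper admM leqnN.
move=> jU ler; have [ltrn|lenr] := ltnP r n; last first.
  by rewrite entry_out ?cardU // diag_init_out.
have [i ei] : exists i : 'I_N, i = r :> nat by exists (Ordinal (leq_trans ltrn leqnN)).
rewrite -{}ei in ler ltrn *; rewrite entry_ord ?cardU // matching_mapE.
have neq : (i == w j) = false.
  by apply: contraNF jU => /eqP e; rewrite (shuffle_inU wE) cardU -e.
by rewrite neq add0r (negbTE jU) ltnNge ler.
Qed.

Lemma matching_map_springer v : springer_fiber F N n (flag_of (matching_map n v)).
Proof.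
have cardU := card_upper admM leqnN.
have := springer_entryP wE (matching_map_canonical v); rewrite cardU => -> j r jU ler.
rewrite entry_matching_map //; apply: eq_diag => l lU.
by rewrite entry_matching_map // diagS (negbTE lU) eqxx.
Qed.

(** Reading each coordinate at the start of its diagonal gives the injectivity of f_M. *)
Lemma entry_init v al :
  v al = entry U (matching_map n v) (cnt U (val al).1) (val al).1.
Proof.
have iU : (val al).1 \notin U by apply/(upper_starts admM)/startsP; exists al.
by rewrite entry_matching_map // diagS (negbTE iU) eqxx /init_coord sum_init.
Qed.

(** By [open_arcs_low] the diagonal starting at [j] stays low enough never to be overwritten or cut
    off by a later pivot, and it ends at row n or below, where it must be 0. *)
Lemma springer_unmatched_init (g : 'M[F]_N) j : canonical_rep w g ->
  springer_fiber F N n (flag_of g) -> j \in unmatched M -> j \notin U ->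
  entry U g (cnt U j) j = 0.
Proof.
have cardU := card_upper admM leqnN.
move=> can; rewrite -{1}cardU => sprg jN jU; set a := fun l : 'I_N => entry U g (cnt U l) l.
have out := springer_diag_out wE can sprg.
have low := open_arcs_low admM jN jU.
(* The row reached by this diagonal before column [p]: it goes down by one at each column outside
   [U] after [j]. *)
pose row p := (cnt U j + (cnt (~: U) p - (cnt (~: U) j).+1))%N.
suff diag_row p : (p <= N)%N -> (j < p)%N -> diag U a p (row p) = a j.
  rewrite -[LHS]/(a j) -(diag_row N) // out //.
  have /low : (j < N <= N)%N by rewrite ltn_ord leqnn.
  by rewrite cntN; apply: leq_trans; rewrite leq_addr.
move: p; apply: leq_ord_ind => // i IH; rewrite ltnS leq_eqVlt => /orP[/eqP/val_inj<-|ltji].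
  by rewrite diagS (negbTE jU) /row cntS in_setC jU add1n subnn addn0 eqxx.
have lowi : (cnt U i <= row i)%N.
  have /low : (j < i <= N)%N by rewrite ltji ltnW.
  by apply: leq_trans; rewrite leq_addr.
have ltc : (cnt (~: U) j < cnt (~: U) i)%N by rewrite cnt_lt ?in_setC.
rewrite diagS -(IH ltji) /row cntS in_setC; have [iU|iU] := boolP (i \in U).
  by rewrite add0n.
have -> : (cnt U j + (true + cnt (~: U) i - (cnt (~: U) j).+1) = (row i).+1)%N.
  by rewrite /row /=; lia.
by rewrite gtn_eqF.
Qed.

Lemma springer_matching_map (g : 'M[F]_N) : canonical_rep w g ->
  springer_fiber F N n (flag_of g) -> exists v, matching_map n v = g.
Proof.
have cardU := card_upper admM leqnN.
move=> can sprg; pose a (l : 'I_N) := entry U g (cnt U l) l.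
pose v : {ffun arc_of M -> F} := [ffun al => a (val al).1]; exists v.
(* At an arc start this is the choice of [v]; at an unmatched column both sides are 0, the right one
   by stability. *)
have va j : j \notin U -> init_coord v j = a j.
  move=> jU; rewrite /init_coord; have [/startsP[al <-]|jS] := boolP (j \in starts M).
    by rewrite sum_init ffunE.
  have jE : j \notin ends M by apply: contra jU => /upper_ends.
  rewrite sum_notinit //; apply/esym/springer_unmatched_init => //.
  by rewrite !inE negb_or jS jE.
apply/matrixP=> i c; have [cU|cU] := boolP (c \in U).
  by rewrite !(canonical_upper wE) //; exact: matching_map_canonical.
have [ltin|lein] := ltnP i n; last first.
  by rewrite !(canonical_bottom wE) ?cardU //; exact: matching_map_canonical.
have [lti|lei] := ltnP i (cnt U c).
  have neq : i != w c.
    by apply: contra cU => /eqP e; rewrite (shuffle_inU wE) cardU -e.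
  by rewrite !(canonical_low wE can) // (canonical_low wE (matching_map_canonical v)).
rewrite -!(entry_ord (U := U)) ?cardU // entry_matching_map //.
rewrite (eq_diag _ _ va); apply/esym.
by have /(springer_entryP wE can) -> : springer_fiber F N #|U| (flag_of g) by rewrite cardU.
Qed.

Lemma springer_cell_bij :
  set_bij [set: {ffun arc_of M -> F}]%classic (springer_cell F n w)
    (fun v => flag_of (matching_map n v)).
Proof.
split=> [v _|v v' _ _ eqV|V [sprV [_ [g [_ can eqV]]]]].
- have can := matching_map_canonical v; have gU := canonical_rep_unitmx can.
  split; first exact: matching_map_springer.
  by split; [exact: flag_of_is_flag | exists (matching_map n v)].
- apply/ffunP=> al; rewrite !entry_init //.
  by rewrite (canonical_rep_uniq (matching_map_canonical v) (matching_map_canonical v') eqV).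
rewrite -eqV in sprV; have [v eqg] := springer_matching_map can sprV.
by exists v => //; rewrite eqg.
Qed.

End MatchingCells.

Theorem theorem4p10 (R : realType) (N n : nat) (n_ge1 : (1 <= n)%N)
    (n_le : (n <= N - 1)%N) :
  (forall w : 'S_N,
     (springer_cell R[i] n w !=set0)%classic <->
     exists M : {set 'I_N * 'I_N},
       admissible n M /\ (forall i : 'I_N, matching_perm n M i = w i :> nat)) /\
  (forall M : {set 'I_N * 'I_N}, admissible n M ->
     exists w : 'S_N,
       [/\ forall i : 'I_N, matching_perm n M i = w i :> nat,
           forall v : {ffun arc_of M -> R[i]}, matching_map n v \in unitmx
         & set_bij [set: {ffun arc_of M -> R[i]}]%classic (springer_cell R[i] n w)
             (fun v => flag_of (matching_map n v))]).
Proof.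
have leqnN : (n <= N)%N by rewrite (leq_trans n_le) ?leq_subr.
split=> [w|M admM].
  split=> [[V [sprV [_ [g [_ can eqV]]]]]|[M [admM wE]]].
    rewrite -eqV in sprV.
    have [cardU wE] := perm_shuffle leqnN (springer_canonical_incr can sprV).
    set U := [set i | (w i < n)%N] in cardU wE.
    (* The matching is read off the lattice path of [U]; its [upper] set is [U] again, so its
       permutation is the shuffle [w]. *)
    have := height_matching_admissible U; have := upper_height_matching U.
    rewrite cardU => upperE admM; exists (height_matching U); split=> // i.
    by rewrite (matching_permE admM leqnN) upperE wE.
  have wE' i : w i = shuffle (upper n M) i :> nat.
    by rewrite -wE (matching_permE admM leqnN).
  have [sub _ _] := springer_cell_bij R[i] leqnN admM wE'.
  by exists (flag_of (matching_map n (0 : {ffun arc_of M -> R[i]}))); apply: sub.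
have wE i : shuffle_perm (upper n M) i = shuffle (upper n M) i :> nat.
  exact: shuffle_permE.
exists (shuffle_perm (upper n M)); split=> [i|v|].
- by rewrite wE (matching_permE admM leqnN).
- exact: canonical_rep_unitmx (matching_map_canonical leqnN admM wE v).
exact: springer_cell_bij leqnN admM wE.
Qed.
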